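(* For every fixed $\epsilon$ with $0<\epsilon\le\frac1{100}$, with high probability, for every integer $k$ with $0\le k<\epsilon^3 n$, \[|\mathcal L_k\cap C_{\tau_{\mathrm{end}}}|\ge (1-2\epsilon)\binom nk.\]
   Context: Let $n\ge 1$ and $\mathcal B=\{0,1\}^n$ with the coordinatewise partial order; $\mathbf 0=(0,\dots,0)$, $\mathbf 1=(1,\dots,1)$, $|x|$ denotes the number of ones of $x$, and $\mathcal L_k=\{x\in\mathcal B:|x|=k\}$ is the $k$th level, so $|\mathcal L_k|=\binom nk$. A random decreasing walk from $\mathbf 1$ is a maximal chain $\mathbf 1=x_n>x_{n-1}>\dots>x_0=\mathbf 0$ with $x_i\in\mathcal L_i$, chosen uniformly among all $n!$ such chains (equivalently, each step turns a uniformly random remaining $1$ into $0$). The DLA process on $\mathcal B$: $C_0=\{\mathbf 0\}$; for $t\ge1$, let $\rho_t$ be a random decreasing walk from $\mathbf 1$, independent of everything before; let $v$ be the last vertex of the longest initial segment of $\rho_t$ that is disjoint from $C_{t-1}$, and set $C_t=C_{t-1}\cup\{v\}$. The process terminates at the first time $\tau_{\mathrm{end}}$ with $\mathbf 1\in C_{\tau_{\mathrm{end}}}$ (for $t>\tau_{\mathrm{end}}$ put $C_t=C_{\tau_{\mathrm{end}}}$). A vertex is occupied at time $t$ if it lies in $C_t$. ''With high probability'' (w.h.p.) means with probability tending to $1$ as $n\to\infty$. *)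

(* Defs.v *)
From Stdlib Require Import Reals.
From mathcomp Require Import all_boot.
From mathcomp Require Import fingroup perm.

Set Implicit Arguments.
Unset Strict Implicit.
Unset Printing Implicit Defensive.

(* A vertex x of B = {0,1}^n is encoded by its set of ones, a {set 'I_n};
   |x| = #|x|.  A maximal decreasing chain from 1 to 0 is encoded by a
   permutation s : 'S_n : step j (j = 0..n-1) turns coordinate s j to 0.
   This is a bijection between the n! chains and 'S_n, so uniform chains
   correspond to uniform permutations. *)

Definition walk_vertex n (s : 'S_n) (j : nat) : {set 'I_n} :=
  [set i | j <= (s^-1)%g i].

(* one DLA step: if 1 is already occupied the process has stopped;
   otherwise m = index of the first walk vertex in C (exists since 0 in C),
   and the last vertex of the initial segment disjoint from C is w_{m-1}. *)
Definition dla_step n (C : {set {set 'I_n}}) (s : 'S_n) : {set {set 'I_n}} :=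
  if setT \in C then C
  else
    let m := find (fun j => walk_vertex s j \in C) (iota 0 n.+1) in
    walk_vertex s m.-1 |: C.

Definition C0 n : {set {set 'I_n}} := [set set0].

Definition dla_run n T (w : {ffun 'I_T -> 'S_n}) : {set {set 'I_n}} :=
  foldl (@dla_step n) (C0 n) [seq w t | t <- enum 'I_T].

(* Every step before termination adds a new vertex, so tau_end <= 2^n - 1,
   and C_{tau_end} = C_{2^n} deterministically. *)
Definition horizon n := 2 ^ n.

Definition final_cluster n (w : {ffun 'I_(horizon n) -> 'S_n}) :=
  dla_run w.

Definition Rleb (a b : R) : bool := if Rle_dec a b then true else false.
Definition Rltb (a b : R) : bool := if Rlt_dec a b then true else false.

Definition level_count n (C : {set {set 'I_n}}) (k : nat) : nat :=
  #|[set x in C | #|x| == k]|.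

(* the event: for all k with k < eps^3 n, |L_k ∩ C_end| >= (1-2eps) C(n,k).
   (k < eps^3 n <= n forces k <= n, so k ranges over 'I_n.+1.) *)
Definition good_event n (eps : R) (w : {ffun 'I_(horizon n) -> 'S_n}) : bool :=
  [forall k : 'I_n.+1,
     Rltb (INR k) (Rmult (pow eps 3) (INR n)) ==>
     Rleb (Rmult (Rminus 1 (Rmult 2 eps)) (INR 'C(n, k)))
          (INR (level_count (final_cluster w) k))].

Definition good_prob n (eps : R) : R :=
  Rdiv (INR #|[set w : {ffun 'I_(horizon n) -> 'S_n} | good_event eps w]|)
       (INR #|{ffun 'I_(horizon n) -> 'S_n}|).

(* Main.v *)
Require Import Defs.
From Stdlib Require Import Reals.
From mathcomp Require Import all_boot.
From mathcomp Require Import fingroup perm.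
From mathcomp Require Import order ssralg ssrnum archimedean reals Rstruct.
From mathcomp Require Import sequences exp.
From mathcomp Require Import lra ring zify.

(** Put t_k = C(n,k+1)/16.  Inductively in k, at time t_k every vertex of level
    k+1 has at most a 2 eps fraction of unoccupied lower neighbours; averaging
    over level k+1 gives the density of level k.

    For y in level k, the probability that a walk through y is stopped above y is
    at most [blocking y C], the sum of 1/C(n-k,|z|-k) over occupied z > y.  No two
    of the first t_k walks meet at level n/10, by a birthday bound, so nothing
    above that level is occupied.  Hence [blocking] is dominated by a sum over the
    walks of i.i.d. variables [exposure] of size O(1/n) and mean O(1/C(n,k+1)),
    and Chernoff's bound makes it at most 1/2 for all y at once.

    If y has half of its lower neighbours occupied at time t_(k-1), each later
    walk then occupies y with probability at least 1/(4 C(n,k)).  A set S of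
    vertices of level k stays vacant up to time t_k with probability at most
    exp(- |S| (t_k - t_(k-1)) / (4 C(n,k))), which for |S| > 2 eps (k+1) is at most
    exp(- eps n / 64).  Since k < eps^3 n, this beats the number C(n,k+1) 2^(k+1)
    of candidate sets S of lower neighbours of a vertex of level k+1. *)

Set Implicit Arguments.
Unset Strict Implicit.
Unset Printing Implicit Defensive.
Import Order.TTheory GRing.Theory Num.Theory.

(** * Binomial coefficients and levels of the cube *)

Lemma mul_bin_bin n j k : k <= j <= n ->
  'C(n, j) * 'C(j, k) = 'C(n, k) * 'C(n - k, j - k).
Proof.
move=> /andP[kj jn].
have fact_prod_gt0 : 0 < k`! * (j - k)`! * (n - j)`! by rewrite !muln_gt0 !fact_gt0.
have subset_sizes : n - k - (j - k) = n - j by lia.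
apply/eqP; rewrite -(eqn_pmul2r fact_prod_gt0); apply/eqP; transitivity n`!.
  by rewrite -(bin_fact jn) -(bin_fact kj); ring.
rewrite -(bin_fact (leq_trans kj jn)) -(bin_fact (leq_sub2r k jn)) subset_sizes.
by ring.
Qed.

Lemma bin_double m i : 3 * i + 2 <= m -> 2 * 'C(m, i) <= 'C(m, i.+1).
Proof.
move=> im; rewrite -(leq_pmul2l (ltn0Sn i)) mul_bin_left mulnCA mulnA.
by apply: leq_mul => //; lia.
Qed.

Lemma exp2_le_bin m i : 3 * i <= m.+1 -> 2 ^ i <= 'C(m, i).
Proof.
elim: i => [|i IHi] im; first by rewrite bin0.
by rewrite expnS; apply: leq_trans (bin_double _); rewrite ?leq_mul2l /= ?IHi //; lia.
Qed.

Lemma bin_le_exp2 m i : 'C(m, i) <= 2 ^ m.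
Proof.
rewrite -[m in 2 ^ m]card_ord -cardsT -card_powerset -[m in 'C(m, i)]card_ord -card_draws.
by apply/subset_leq_card/subsetP => A _; rewrite powersetE subsetT.
Qed.

Lemma sum_inv_doubling_le (R : realFieldType) (c : nat -> nat) p q :
  0 < c p -> (forall j, p <= j -> j.+1 < q -> 2 * c j <= c j.+1) ->
  (\sum_(p <= j < q) ((c j)%:R)^-1 <= 2 / (c p)%:R :> R)%R.
Proof.
have [m] := ubnP (q - p); elim: m p => // m IHm p ltm cp_gt0 doubling.
have [qp|pq] := leqP q p; first by rewrite big_geq // divr_ge0.
have [qp|pq1] := leqP q p.+1.
  have -> : q = p.+1 by lia.
  by rewrite big_nat1 ler_peMl ?invr_ge0 // ler1n.
have double_p := doubling p (leqnn p) pq1.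
rewrite big_ltn // mulr_natl mulr2n lerD2l; apply: le_trans (IHm p.+1 _ _ _) _.
- by lia.
- by apply: leq_trans double_p; rewrite muln_gt0.
- by move=> j pj; apply: doubling; apply: ltnW.
rewrite ler_pdivrMr ?ltr0n; last by apply: leq_trans double_p; rewrite muln_gt0.
by rewrite mulrC ler_pdivlMr ?ltr0n // -natrM ler_nat.
Qed.

Section Levels.
Variable T : finType.
Implicit Types (x y z : {set T}) (A : {set {set T}}) (g : {perm T}).

Definition level k : {set {set T}} := [set x : {set T} | #|x| == k].

Definition shadow x : {set {set T}} := [set y : {set T} | (y \subset x) && (#|x| == #|y|.+1)].

Lemma in_level k x : (x \in level k) = (#|x| == k).
Proof. by rewrite inE. Qed.

Lemma card_level k : #|level k| = 'C(#|T|, k).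
Proof. exact: card_draws. Qed.

Lemma card_shadow x : #|shadow x| = #|x|.
Proof.
case cx: #|x| => [|m].
  by apply: eq_card0 => y; rewrite inE cx andbF.
rewrite -binSn -cx -cards_draws; apply: eq_card => y.
by rewrite !inE cx eqSS eq_sym.
Qed.

Lemma shadow_level k x y : x \in level k.+1 -> y \in shadow x -> y \in level k.
Proof. by rewrite !inE => /eqP -> /andP[_]; rewrite eqSS eq_sym. Qed.

Lemma card_supersets y j : #|y| <= j <= #|T| ->
  #|[set z in level j | y \subset z]| = 'C(#|T| - #|y|, j - #|y|).
Proof.
move=> /andP[yj jT].
have codim : #|T| - #|y| - (#|T| - j) = j - #|y| by lia.
have card_compl x : #|~: x| = #|T| - #|x| by rewrite cardsCs setCK.
rewrite -codim bin_sub ?leq_sub2l // -card_compl -cards_draws.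
rewrite -[RHS](card_imset _ (@setC_inj T)); apply: eq_card => z.
rewrite -[z]setCK (mem_imset _ _ (@setC_inj T)) !inE setCS andbC !setCK card_compl.
by rewrite eqn_sub2lE ?max_card.
Qed.

Lemma sum_card_shadow_setI A k : k < #|T| ->
  \sum_(x in level k.+1) #|shadow x :&: A| = (#|T| - k) * #|level k :&: A|.
Proof.
move=> kT; transitivity (\sum_(x in level k.+1) \sum_(y in shadow x :&: A) 1).
  by apply: eq_bigr => x _; rewrite sum1_card.
rewrite (exchange_big_dep (mem (level k :&: A))) /= => [|x y x_level]; last first.
  by rewrite !in_setI => /andP[/(shadow_level x_level) ->].
rewrite mulnC -sum_nat_const; apply: eq_bigr => y; rewrite in_setI => /andP[yk yA].
move: yk kT; rewrite in_level => /eqP <- yT.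
rewrite -[RHS]bin1 -[X in 'C(_, X)](subSnn #|y|) -card_supersets ?leqnSn // -[RHS]sum1_card.
by apply: eq_bigl => x; rewrite !inE yA andbT; case: eqP; rewrite /= ?andbT.
Qed.

Lemma card_level_setI_le (R : realFieldType) A k (theta : R) : k < #|T| ->
  (forall x, x \in level k.+1 -> #|shadow x :&: A|%:R <= theta * k.+1%:R)%R ->
  (#|level k :&: A|%:R <= theta * 'C(#|T|, k)%:R)%R.
Proof.
move=> kT shadow_le; have codim_gt0 : (0 < (#|T| - k)%:R :> R)%R by rewrite ltr0n subn_gt0.
rewrite -(ler_pM2l codim_gt0) -natrM -sum_card_shadow_setI // natr_sum mulrCA.
rewrite -natrM -mul_bin_left natrM mulrA mulr_natr -card_level -sumr_const.
exact: ler_sum.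
Qed.

(* Exchanging an element of y \ y' with one of y' \ y brings y closer to y'. *)
Lemma exists_perm_imset z y y' : y \subset z -> y' \subset z -> #|y| = #|y'| ->
  exists2 g, perm_on z g & g @: y = y'.
Proof.
have [m] := ubnP #|y :\: y'|; elim: m y => // m IHm y ltm yz y'z eq_card_yy'.
have [sub_yy'|/subsetPn[a ay ay']] := boolP (y \subset y').
  exists 1%g; first exact: perm_on1.
  rewrite (eq_imset (g := id)) => [|i]; last by rewrite perm1.
  by rewrite imset_id; apply/eqP; rewrite eqEcard sub_yy' eq_card_yy' /=.
have /subsetPn[b by' b_notin_y] : ~~ (y' \subset y).
  apply: contra ay' => sub_y'y; suff -> : y' = y by [].
  by apply/eqP; rewrite eqEcard sub_y'y eq_card_yy' /=.
pose t := tperm a b.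
have zt : perm_on z t.
  apply: subset_trans (tperm_on a b) _; rewrite subUset !sub1set.
  by rewrite (subsetP yz) ?(subsetP y'z).
have card_ty : #|t @: y| = #|y'| by rewrite card_imset //; exact: perm_inj.
have closer : t @: y :\: y' \subset (y :\: y') :\ a.
  apply/subsetP => i; rewrite !inE => /andP[iy' /imsetP[j jy def_i]].
  move: iy'; rewrite def_i /t; case: tpermP => [_|jb|/eqP ja _ jy'].
  - by rewrite by'.
  - by rewrite -jb jy in b_notin_y.
  - by rewrite ja jy' jy.
have [||g zg <-] := IHm (t @: y) _ _ y'z card_ty.
- apply: leq_ltn_trans (subset_leq_card closer) _.
  by move: ltm; rewrite (cardsD1 a (y :\: y')) inE ay ay'.
- by rewrite -(im_perm_on zt) imsetS.
exists (t * g)%g; first exact: perm_onM.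
by rewrite -imset_comp; apply: eq_imset => i; rewrite /= permM.
Qed.

End Levels.

Arguments level {T} k.

(** * Expectation over sequences of independent uniform choices *)

Section Expectation.
Local Open Scope ring_scope.
Variables (R : realFieldType) (S : finType).
Implicit Types (f g : S -> R) (F G : seq S -> R) (P Q : pred (seq S)).

Definition avg f : R := (\sum_s f s) / #|S|%:R.

Lemma eq_avg f g : f =1 g -> avg f = avg g.
Proof. by move=> fg; rewrite /avg (eq_bigr g). Qed.

Lemma avg0 f : (forall s, f s = 0) -> avg f = 0.
Proof. by move=> f0; rewrite /avg big1 ?mul0r. Qed.

Lemma le_avg f g : (forall s, f s <= g s) -> avg f <= avg g.
Proof. by move=> fg; rewrite ler_wpM2r ?invr_ge0 ?ler0n //; apply: ler_sum. Qed.

Lemma avg_sum (I : Type) (r : seq I) (A : pred I) (f : I -> S -> R) :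
  avg (fun s => \sum_(i <- r | A i) f i s) = \sum_(i <- r | A i) avg (f i).
Proof. by rewrite /avg exchange_big /= mulr_suml. Qed.

Lemma avgD f g : avg (fun s => f s + g s) = avg f + avg g.
Proof. by rewrite /avg big_split mulrDl. Qed.

Lemma avgZ c f : avg (fun s => c * f s) = c * avg f.
Proof. by rewrite /avg -mulr_sumr mulrA. Qed.

Fixpoint expect (t : nat) F : R :=
  if t is t'.+1 then avg (fun s => expect t' (fun l => F (s :: l))) else F [::].

Definition prob t P : R := expect t (fun l => (P l)%:R).

Lemma le_expect t F G : (forall l, size l = t -> F l <= G l) -> expect t F <= expect t G.
Proof.
elim: t F G => [|t IHt] F G leFG /=; first exact: leFG.
by apply: le_avg => s; apply: IHt => l sl; apply: leFG; rewrite /= sl.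
Qed.

Lemma eq_expect t F G : (forall l, size l = t -> F l = G l) -> expect t F = expect t G.
Proof. by move=> FG; apply/le_anti; rewrite !le_expect // => l /FG ->. Qed.

Lemma expect_sum t (I : Type) (r : seq I) (A : pred I) (F : I -> seq S -> R) :
  expect t (fun l => \sum_(i <- r | A i) F i l) = \sum_(i <- r | A i) expect t (F i).
Proof.
elim: t F => //= t IHt F; rewrite -avg_sum; apply: eq_avg => s; exact: IHt.
Qed.

Lemma expectD t F G : expect t (fun l => F l + G l) = expect t F + expect t G.
Proof. by elim: t F G => //= t IHt F G; rewrite -avgD; apply: eq_avg => s; exact: IHt. Qed.

Lemma expectZ t c F : expect t (fun l => c * F l) = c * expect t F.
Proof. by elim: t F => //= t IHt F; rewrite -avgZ; apply: eq_avg => s; exact: IHt. Qed.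

Lemma expect_prod t f : expect t (fun l => \prod_(s <- l) f s) = avg f ^+ t.
Proof.
elim: t => [|t IHt] /=; first by rewrite big_nil.
rewrite exprSr -avgZ; apply: eq_avg => s; rewrite -IHt mulrC -expectZ.
by apply: eq_expect => l _; rewrite big_cons.
Qed.

Lemma expect_cat t d F :
  expect (t + d) F = expect t (fun l => expect d (fun l' => F (l ++ l'))).
Proof. by elim: t F => //= t IHt F; apply: eq_avg => s; exact: IHt. Qed.

Lemma le_prob t P Q : (forall l, size l = t -> P l -> Q l) -> prob t P <= prob t Q.
Proof.
by move=> PQ; apply: le_expect => l /PQ; case: (P l) => [->|_]; rewrite ?ler0n.
Qed.

Lemma eq_prob t P Q : (forall l, size l = t -> P l = Q l) -> prob t P = prob t Q.
Proof. by move=> PQ; apply: eq_expect => l /PQ ->. Qed.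

Lemma prob0 t P : (forall l, size l = t -> ~~ P l) -> prob t P = 0.
Proof.
rewrite /prob; elim: t P => [|t IHt] P notP /=; first by rewrite (negbTE (notP _ _)).
by apply: avg0 => s; apply: (IHt (fun l => P (s :: l))) => l sl; apply: notP; rewrite /= sl.
Qed.

Lemma prob_or t P Q : prob t (fun l => P l || Q l) <= prob t P + prob t Q.
Proof.
by rewrite -expectD; apply: le_expect => l _; rewrite -natrD ler_nat; case: P; case: Q.
Qed.

Lemma prob_exists t (I : finType) (A : {pred I}) (Q : I -> pred (seq S)) q :
  (forall i, i \in A -> prob t (Q i) <= q) ->
  prob t (fun l => [exists i in A, Q i l]) <= #|A|%:R * q.
Proof.
move=> leQ; apply: le_trans (_ : \sum_(i in A) prob t (Q i) <= _); last first.
  by rewrite mulr_natl -sumr_const; apply: ler_sum.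
rewrite /prob -expect_sum; apply: le_expect => l _.
have [/existsP[i /andP[Ai Qi]]|_] := boolP [exists i in A, Q i l]; last first.
  by apply: sumr_ge0 => i _; rewrite ler0n.
by rewrite (bigD1 i Ai) /= Qi lerDl; apply: sumr_ge0 => j _; rewrite ler0n.
Qed.

Lemma expect_tuple T F :
  expect T F = (\sum_(t : T.-tuple S) F t) / #|{: T.-tuple S}|%:R.
Proof.
elim: T F => [|T IHT] F /=.
  rewrite card_tuple expn0 divr1 (bigD1 [tuple]) //= big1 ?addr0 // => t.
  by rewrite [t]tuple0.
rewrite (eq_avg (fun s => IHT (fun l => F (s :: l)))) /avg.
rewrite -mulr_suml !card_tuple expnSr natrM -mulrA -invfM; congr (_ / _).
rewrite pair_big /= (reindex (fun p : S * T.-tuple S => [tuple of p.1 :: p.2])) //=.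
exists (fun t => (thead t, [tuple of behead t])) => /= [[s t] _|t _] /=.
  by congr pair; apply: val_inj.
by rewrite [RHS]tuple_eta; apply: val_inj.
Qed.

Lemma prob_ffun T P :
  prob T P =
  #|[set w : {ffun 'I_T -> S} | P [seq w t | t <- enum 'I_T]]|%:R / #|{ffun 'I_T -> S}|%:R.
Proof.
rewrite /prob expect_tuple card_ffun card_tuple card_ord; congr (_ / _).
rewrite -sum1dep_card natr_sum [RHS]big_mkcond /=.
rewrite [RHS](reindex (fun t : T.-tuple S => [ffun i => tnth t i])) /=; last first.
  exists (fun w : {ffun 'I_T -> S} => [tuple w i | i < T]) => [t _|w _].
    by apply: eq_from_tnth => i; rewrite tnth_mktuple ffunE.
  by apply/ffunP => i; rewrite ffunE tnth_mktuple.
apply: eq_bigr => t _.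
have -> : [seq [ffun i => tnth t i] i | i <- enum 'I_T] = t.
  by rewrite -[RHS]map_tnth_enum; apply: eq_map => i; rewrite ffunE.
by case: (P t).
Qed.

Hypothesis S_gt0 : (0 < #|S|)%N.

Lemma avg_cst c : avg (fun=> c) = c.
Proof. by rewrite /avg sumr_const -(mulr_natr c) mulfK // pnatr_eq0 -lt0n. Qed.

Lemma expect_cst t c : expect t (fun=> c) = c.
Proof.
by elim: t => //= t IHt; rewrite -[RHS]avg_cst; apply: eq_avg.
Qed.

Lemma prob_take t T P : (t <= T)%N -> prob T (fun l => P (take t l)) = prob t P.
Proof.
move=> /subnKC <-; rewrite /prob expect_cat; apply: eq_expect => l sl.
by rewrite -[RHS](expect_cst (T - t)); apply: eq_expect => l' _; rewrite take_size_cat.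
Qed.

Lemma probC t P : prob t (fun l => ~~ P l) = 1 - prob t P.
Proof.
apply/esym/eqP; rewrite subr_eq -expectD -[X in X == _](expect_cst t); apply/eqP.
by apply: eq_expect => l _; case: (P l); rewrite ?addr0 ?add0r.
Qed.

End Expectation.

Section Chernoff.
Local Open Scope ring_scope.
Variables (R : realType) (S : finType).
Hypothesis S_gt0 : (0 < #|S|)%N.
Implicit Types f : S -> R.

Lemma expR_le1D2x (x : R) : 0 <= x <= 2^-1 -> expR x <= 1 + 2 * x.
Proof.
move=> /andP[x_ge0 x_le]; have x_lt1 : 0 < 1 - x by lra.
have inverse_bound : (1 - x) * expR x <= 1.
  by rewrite -ler_pdivlMr ?expR_gt0 // div1r -expRN expR_ge1Dx.
by rewrite -(ler_pM2l x_lt1); apply: le_trans inverse_bound _; nra.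
Qed.

Lemma prob_sum_gt_le t f (theta lambda : R) :
  0 <= lambda -> (forall s, 0 <= lambda * f s <= 2^-1) ->
  prob R t (fun l => theta < \sum_(s <- l) f s) <=
  expR (2 * lambda * avg f * t%:R - lambda * theta).
Proof.
move=> lambda_ge0 f_bounds.
apply: le_trans (_ : expect t (fun l =>
    expR (- (lambda * theta)) * \prod_(s <- l) expR (lambda * f s)) <= _).
  apply: le_expect => l _; rewrite -expR_sum -mulr_sumr -expRD.
  case: (boolP (theta < _)) => [/ltW le_sum|_]; last exact: expR_ge0.
  by rewrite -[1%:R]expR0 ler_expR addrC subr_ge0 ler_wpM2l.
rewrite expectZ expect_prod addrC expRD ler_pM2l ?expR_gt0 //.
rewrite expRM_natr lerXn2r ?nnegrE ?expR_ge0 //.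
  by rewrite -(avg_cst S_gt0 0); apply: le_avg => s; exact: expR_ge0.
apply: le_trans (expR_ge1Dx _); rewrite -avgZ -[X in X + _](avg_cst S_gt0) -avgD.
by apply: le_avg => s; rewrite -mulrA; apply: expR_le1D2x.
Qed.

End Chernoff.

(** * Random decreasing walks *)

Section Walks.
Variable n : nat.
Implicit Types (s g : 'S_n) (y z : {set 'I_n}) (Z : pred 'S_n).

Definition level_vertex s k := walk_vertex s (n - k).

Definition passes s y := level_vertex s #|y| == y.

Lemma walk_vertex_imset s j : walk_vertex s j = s @: [set i : 'I_n | j <= i].
Proof.
apply/setP => i; rewrite inE; apply/idP/imsetP => [ji|[i0]].
  by exists ((s^-1)%g i); rewrite ?inE // permKV.
by rewrite inE => ji0 ->; rewrite permK.
Qed.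

Lemma card_walk_vertex s j : #|walk_vertex s j| = n - j.
Proof.
rewrite walk_vertex_imset card_imset; last exact: perm_inj.
rewrite cardsE -sum1_card (eq_bigl (fun i : 'I_n => j <= i)) //.
rewrite -(big_mkord (fun i => j <= i) (fun _ => 1)).
by rewrite -(big_nat_widenl j 0 n predT (fun=> 1)) // sum_nat_const_nat muln1.
Qed.

Lemma card_level_vertex s k : k <= n -> #|level_vertex s k| = k.
Proof. by move=> kn; rewrite card_walk_vertex subKn. Qed.

Lemma level_vertex_in_level s k : k <= n -> level_vertex s k \in level k.
Proof. by move=> kn; rewrite in_level card_level_vertex. Qed.

Lemma level_vertex_subset s k k' : k <= k' -> level_vertex s k \subset level_vertex s k'.
Proof.
by move=> kk'; apply/subsetP => i; rewrite !inE; apply/leq_trans/leq_sub2l.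
Qed.

Lemma level_vertex0 s : level_vertex s 0 = set0.
Proof. by apply/eqP; rewrite -cards_eq0 card_level_vertex. Qed.

Lemma level_vertexn s : level_vertex s n = setT.
Proof. by apply/eqP; rewrite eqEcard subsetT cardsT card_ord card_level_vertex /=. Qed.

Lemma card_subset_ord y : #|y| <= n.
Proof. by rewrite -[n in _ <= n]card_ord max_card. Qed.

Lemma passesE s k y : #|y| = k -> passes s y = (level_vertex s k == y).
Proof. by move=> <-. Qed.

Lemma passes_setT s : passes s setT.
Proof. by rewrite /passes cardsT card_ord level_vertexn. Qed.

Lemma passes_subset s y z : passes s y -> passes s z -> #|y| <= #|z| -> y \subset z.
Proof. by move=> /eqP {2}<- /eqP {2}<-; apply: level_vertex_subset. Qed.

Lemma passes_mulg s g y : passes (s * g)%g (g @: y) = passes s y.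
Proof.
have level_vertex_mulg k : level_vertex (s * g)%g k = g @: level_vertex s k.
  rewrite /level_vertex !walk_vertex_imset -imset_comp.
  by apply: eq_imset => i; rewrite /= permM.
rewrite /passes card_imset ?level_vertex_mulg; last exact: perm_inj.
exact: inj_eq (imset_inj perm_inj) _ _.
Qed.

Definition perm_on_invariant z Z := forall s g, perm_on z g -> Z (s * g)%g = Z s.

Lemma passes_invariant y z : y \subset z -> perm_on_invariant y (passes^~ z).
Proof.
by move=> yz s g yg; rewrite -{1}(im_perm_on (subset_trans yg yz)) passes_mulg.
Qed.

Lemma card_perm_gt0 : 0 < #|'S_n|.
Proof. by rewrite card_Sn fact_gt0. Qed.

Section Probabilities.
Local Open Scope ring_scope.
Variable R : realFieldType.

Lemma avg_mulg g (F : 'S_n -> R) : avg (fun s => F (s * g)%g) = avg F.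
Proof. by rewrite /avg [in RHS](reindex_inj (mulIg g)). Qed.

Lemma avg_level_vertex k (F : 'S_n -> {set 'I_n} -> R) : (k <= n)%N ->
  avg (fun s => F s (level_vertex s k)) =
  \sum_(y in level k) avg (fun s => (passes s y)%:R * F s y).
Proof.
move=> kn; rewrite -avg_sum; apply: eq_avg => s.
rewrite (bigD1 (level_vertex s k)) ?level_vertex_in_level //=.
rewrite (passesE s (card_level_vertex s kn)) eqxx mul1r big1 ?addr0 // => y.
rewrite in_level => /andP[/eqP yk]; rewrite (passesE s yk) eq_sym.
by move=> /negbTE ->; rewrite mul0r.
Qed.

(* Permutations supported on z act transitively on the subsets of z of a given size. *)
Lemma prob_passes_subset y z Z : y \subset z -> perm_on_invariant z Z ->
  avg (fun s => [&& passes s y, passes s z & Z s]%:R) =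
  avg (fun s => (passes s z && Z s)%:R) / 'C(#|z|, #|y|)%:R :> R.
Proof.
move=> yz invZ; have cyz := subset_leq_card yz.
pose F y' : R := avg (fun s => [&& passes s y', passes s z & Z s]%:R).
have F_const y' : y' \subset z -> #|y'| = #|y| -> F y' = F y.
  move=> y'z eq_card_y'y; have [g zg <-] := exists_perm_imset yz y'z (esym eq_card_y'y).
  rewrite -[LHS](avg_mulg g); apply: eq_avg => s.
  by rewrite /= passes_mulg (passes_invariant (subxx z)) ?invZ.
have F_out y' : ~~ (y' \subset z) -> #|y'| = #|y| -> F y' = 0.
  move=> y'z eq_card_y'y; apply: avg0 => s.
  case: (boolP (passes s y')) => //= py'.
  case: (boolP (passes s z)) => //= pz.
  by rewrite (passes_subset py' pz) ?eq_card_y'y in y'z.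
have C_neq0 : 'C(#|z|, #|y|)%:R != 0 :> R by rewrite pnatr_eq0 -lt0n bin_gt0.
apply: (mulIf C_neq0); rewrite divfK // -/(F y).
rewrite (avg_level_vertex (fun s _ => (passes s z && Z s)%:R) (card_subset_ord y)).
transitivity (\sum_(y' in level #|y|) F y'); last first.
  by apply: eq_bigr => y' _; apply: eq_avg => s; rewrite -natrM mulnb.
rewrite (bigID (fun y' : {set 'I_n} => y' \subset z)) /= [X in _ + X]big1 ?addr0; last first.
  by move=> y' /andP[]; rewrite in_level => /eqP eq_card_y'y /F_out ->.
rewrite -(cards_draws z) mulr_natr -sumr_const; apply: eq_big => y'.
  by rewrite !inE andbC.
by rewrite inE => /andP[y'z /eqP /(F_const _ y'z) ->].
Qed.

Lemma prob_passes y : avg (fun s => (passes s y)%:R) = ('C(n, #|y|)%:R)^-1 :> R.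
Proof.
have invT : perm_on_invariant setT predT by [].
have := prob_passes_subset (subsetT y) invT; rewrite cardsT card_ord.
rewrite (eq_avg (g := fun s => (passes s y)%:R)) => [->|s]; last first.
  by rewrite passes_setT andbT.
rewrite (eq_avg (g := fun=> 1)) => [|s]; last by rewrite passes_setT.
by rewrite (avg_cst card_perm_gt0) div1r.
Qed.

Lemma prob_passes_pair y z : y \subset z ->
  avg (fun s => (passes s y && passes s z)%:R) =
  ('C(n, #|z|)%:R)^-1 / 'C(#|z|, #|y|)%:R :> R.
Proof.
move=> yz; have invT : perm_on_invariant z predT by [].
have := prob_passes_subset yz invT.
rewrite (eq_avg (g := fun s => (passes s y && passes s z)%:R)) => [->|s]; last first.
  by rewrite andbT.
by rewrite -prob_passes; congr (_ / _); apply: eq_avg => s; rewrite andbT.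
Qed.

Lemma prob_subset_level_vertex y j : (#|y| <= j <= n)%N ->
  avg (fun s => (y \subset level_vertex s j)%:R) =
  'C(n - #|y|, j - #|y|)%:R / 'C(n, j)%:R :> R.
Proof.
move=> yjn; have /andP[_ jn] := yjn.
rewrite (avg_level_vertex (fun _ z => (y \subset z)%:R) jn) -[n in 'C(n - _, _)]card_ord.
rewrite -card_supersets ?card_ord // mulr_natl -sumr_const.
rewrite [RHS](eq_bigl (fun z => (z \in level j) && (y \subset z))) => [|z]; last first.
  by rewrite inE.
rewrite big_mkcondr; apply: eq_bigr => z; rewrite in_level => /eqP zj.
case: (y \subset z).
  by rewrite -zj -prob_passes; apply: eq_avg => s; rewrite mulr1.
by rewrite avg0 // => s; rewrite mulr0.
Qed.

End Probabilities.
End Walks.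

(** * The cluster *)

Section Cluster.
Variable n : nat.
Implicit Types (s : 'S_n) (y z : {set 'I_n}) (C : {set {set 'I_n}}) (l : seq 'S_n).

Definition cluster l : {set {set 'I_n}} := foldl (@dla_step n) (C0 n) l.

Definition unobstructed y C s := [forall z in C, (y \proper z) ==> ~~ passes s z].

Lemma sub_dla_step C s : C \subset dla_step C s.
Proof. by rewrite /dla_step; case: ifP => // _; apply: subsetUr. Qed.

Lemma sub_foldl_dla_step C l : C \subset foldl (@dla_step n) C l.
Proof. by elim: l C => //= s l IHl C; apply: subset_trans (sub_dla_step C s) (IHl _). Qed.

Lemma sub_cluster_take t l : cluster (take t l) \subset cluster l.
Proof.
by rewrite -[l in _ \subset cluster l](cat_take_drop t) /cluster foldl_cat sub_foldl_dla_step.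
Qed.

Lemma set0_cluster l : set0 \in cluster l.
Proof. by apply: (subsetP (sub_foldl_dla_step _ l)); rewrite inE. Qed.

Lemma dla_stepP C s j : j <= n -> level_vertex s j \in C -> setT \notin C ->
  exists k, [/\ j <= k < n, level_vertex s k \in C, dla_step C s = level_vertex s k.+1 |: C
    & forall i, k < i <= n -> level_vertex s i \notin C].
Proof.
move=> jn jC TC; rewrite /dla_step (negbTE TC).
pose occupied i := walk_vertex s i \in C; rewrite -/occupied; cbv zeta.
set m := find occupied _.
have before_m i : i < m -> i <= n -> ~~ occupied i.
  by move=> im ni; have := before_find 0 im; rewrite nth_iota // => ->.
have m_le : m <= n - j.
  by rewrite leqNgt; apply/negP => /before_m/(_ (leq_subr j n))/negP; apply.
have occupied_m : occupied m.
  have hasC : has occupied (iota 0 n.+1) by rewrite has_find size_iota; lia.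
  by have := nth_find 0 hasC; rewrite nth_iota //; lia.
have m_gt0 : 0 < m.
  rewrite lt0n; apply: contraNneq TC => m0.
  by rewrite -(level_vertexn s) /level_vertex subnn -m0.
exists (n - m); split; [by lia | | |].
- by rewrite /level_vertex subKn //; lia.
- by congr (walk_vertex s _ |: C); lia.
- by move=> i i_bounds; apply: before_m; lia.
Qed.

Lemma dla_step_adds C s y z : setT \notin C -> y \notin C -> z \in shadow y -> z \in C ->
  passes s y -> passes s z -> unobstructed y C s -> y \in dla_step C s.
Proof.
move=> TC yC; rewrite inE => /andP[_ /eqP card_y] zC py pz /forallP unobst.
have cyn := card_subset_ord y.
have zC' : level_vertex s #|z| \in C by rewrite (eqP pz).
have [k [/andP[zk kn] kC -> _]] := dla_stepP (card_subset_ord z) zC' TC.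
suff k_lt : k < #|y| by rewrite (_ : k.+1 = #|y|) ?(eqP py) ?setU11 //; lia.
rewrite ltnNge; apply/negP => yk.
have y_sub : y \subset level_vertex s k by rewrite -(eqP py) level_vertex_subset.
have := unobst (level_vertex s k); rewrite kC properEneq y_sub andbT => /implyP.
rewrite (passesE s (card_level_vertex s (ltnW kn))) eqxx implybF negbK => /(_ isT)/eqP y_def.
by rewrite y_def kC in yC.
Qed.

(* A vertex above level a sticks to an occupied vertex of level a, which an earlier
   walk has visited. *)
Lemma card_cluster_le a l z : 0 < a <= n -> uniq [seq level_vertex s a | s <- l] ->
  z \in cluster l -> #|z| <= a.
Proof.
move=> /andP[a_gt0 an].
suff visited_below : uniq [seq level_vertex s a | s <- l] -> z \in cluster l ->
    #|z| <= a /\ (#|z| = a -> z \in [seq level_vertex s a | s <- l]).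
  by move=> visited_uniq /(visited_below visited_uniq)[].
elim/last_ind: l z => [z _|l s IHl z].
  by rewrite inE => /eqP ->; rewrite cards0; split => // a0; rewrite -a0 in a_gt0.
rewrite map_rcons rcons_uniq => /andP[s_new visited_uniq].
rewrite /cluster foldl_rcons -/(cluster l) mem_rcons inE.
have [TC|TC] := boolP (setT \in cluster l).
  rewrite /dla_step TC => /(IHl _ visited_uniq)[-> visited].
  by split => // /visited ->; rewrite orbT.
have s0C : level_vertex s 0 \in cluster l by rewrite level_vertex0 set0_cluster.
have [k [/andP[_ kn] kC -> _]] := dla_stepP (leq0n n) s0C TC.
rewrite in_setU1 => /orP[/eqP ->|/(IHl _ visited_uniq)[-> visited]]; last first.
  by split => // /visited ->; rewrite orbT.
rewrite card_level_vertex //; split=> [|->]; last by rewrite eqxx.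
have [ka visited] := IHl _ visited_uniq kC.
rewrite card_level_vertex ?(ltnW kn) // in ka visited.
by rewrite ltn_neqAle ka andbT; apply: contraNneq s_new => k_eq; rewrite -{1}k_eq visited.
Qed.

End Cluster.

(** * Sticking probabilities *)

Section Sticking.
Local Open Scope ring_scope.
Variables (R : realType) (n : nat).
Implicit Types (s : 'S_n) (y z : {set 'I_n}) (C S : {set {set 'I_n}}) (l : seq 'S_n).

(* A walk through y visits z above y with probability 1 / C(n - |y|, |z| - |y|). *)
Definition blocking y C : R :=
  \sum_(z in C | y \proper z) ('C(n - #|y|, #|z| - #|y|)%:R)^-1.

Definition half_supported y C := (#|y| <= 2 * #|shadow y :&: C|)%N.

Definition sticks y C s :=
  [&& passes s y, level_vertex s #|y|.-1 \in C & unobstructed y C s].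

Definition spared S C := [disjoint S & C] && [forall y in S, blocking y C <= 2^-1].

Lemma unobstructed_invariant y C : perm_on_invariant y (unobstructed y C).
Proof.
move=> s g yg; apply: eq_forallb => z; case: (boolP (y \proper z)) => //= yz.
by rewrite (passes_invariant (proper_sub yz)).
Qed.

Lemma prob_unobstructed_ge y C :
  ('C(n, #|y|)%:R)^-1 * (1 - blocking y C) <=
  avg (fun s => (passes s y && unobstructed y C s)%:R) :> R.
Proof.
rewrite mulrBr mulr1 lerBlDr -prob_passes.
have -> : avg (fun s => (passes s y)%:R) * blocking y C =
    avg (fun s => \sum_(z in C | y \proper z) (passes s y && passes s z)%:R).
  rewrite avg_sum mulr_sumr; apply: eq_bigr => z /andP[_ /proper_sub yz].
  rewrite prob_passes prob_passes_pair // -!invfM -!natrM mul_bin_bin //.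
  by rewrite subset_leq_card ?card_subset_ord.
rewrite -avgD; apply: le_avg => s; case py: (passes s y) => /=; last first.
  by rewrite add0r sumr_ge0.
have [_|/forallPn[z]] := boolP (unobstructed y C s); first by rewrite lerDl sumr_ge0.
rewrite 2!negb_imply negbK => /and3P[zC yz pz].
by rewrite add0r (bigD1 z) ?zC //= pz lerDl sumr_ge0.
Qed.

Lemma prob_sticks y C : (0 < #|y|)%N ->
  avg (fun s => (sticks y C s)%:R) =
  #|shadow y :&: C|%:R * (avg (fun s => (passes s y && unobstructed y C s)%:R) / #|y|%:R) :> R.
Proof.
move=> y_gt0; have cyn := card_subset_ord y.
pose Z s z := [&& passes s y, z \in C & unobstructed y C s].
rewrite (avg_level_vertex (fun s z => (Z s z)%:R) (leq_trans (leq_pred #|y|) cyn)).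
rewrite mulr_natl -sumr_const.
rewrite (bigID (fun z => z \in shadow y :&: C)) /= [X in _ + X]big1 ?addr0; last first.
  move=> z /andP[]; rewrite !inE => /eqP zy z_out; apply: avg0 => s.
  rewrite -natrM mulnb; apply/eqP; rewrite pnatr_eq0 eqb0; apply: contra z_out.
  move=> /and4P[pz py zC _]; rewrite zC (passes_subset pz py) ?zy ?leq_pred //.
  by rewrite prednK ?eqxx.
apply: eq_big => z.
  rewrite !inE andb_idl // => /andP[/andP[_ /eqP ->] _]; exact: eqxx.
rewrite !inE => /andP[_ /andP[/andP[zy /eqP card_y] zC]].
have -> : avg (fun s => (passes s z)%:R * (Z s z)%:R) =
    avg (fun s => [&& passes s z, passes s y & unobstructed y C s]%:R) :> R.
  by apply: eq_avg => s; rewrite -natrM mulnb /Z zC.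
rewrite (prob_passes_subset R zy (@unobstructed_invariant y C)); congr (_ / _%:R).
by rewrite card_y binSn.
Qed.

Lemma prob_sticks_ge y C : (0 < #|y|)%N -> half_supported y C -> blocking y C <= 2^-1 ->
  ((4 * 'C(n, #|y|))%:R)^-1 <= avg (fun s => (sticks y C s)%:R) :> R.
Proof.
move=> y_gt0; rewrite /half_supported -(ler_nat R) natrM => support unblocked.
have y_gt0R : (0 : R) < #|y|%:R by rewrite ltr0n.
rewrite prob_sticks // mulrA ler_pdivlMr // natrM invfM.
have := prob_unobstructed_ge y C; set q := ('C(n, #|y|)%:R)^-1 => prob_ge.
have q_ge0 : 0 <= q by rewrite invr_ge0.
have prob_ge_half : q / 2 <= avg (fun s => (passes s y && unobstructed y C s)%:R).
  by apply: le_trans prob_ge; apply: ler_wpM2l => //; lra.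
apply: le_trans (ler_wpM2l (ler0n _ _) prob_ge_half).
have -> : #|shadow y :&: C|%:R * (q / 2) = 4^-1 * q * (2 * #|shadow y :&: C|%:R) by field.
by rewrite ler_wpM2l // mulr_ge0 // invr_ge0.
Qed.

Lemma sticks_dla_step y C s : (0 < #|y|)%N -> setT \notin C -> y \notin C ->
  sticks y C s -> y \in dla_step C s.
Proof.
move=> y_gt0 TC yC /and3P[py zC unobst].
have pred_le : (#|y|.-1 <= n)%N := leq_trans (leq_pred _) (card_subset_ord y).
apply: (dla_step_adds TC yC _ zC py _ unobst); last first.
  by rewrite (passesE s (card_level_vertex s pred_le)).
rewrite inE card_level_vertex // prednK // eqxx andbT -{2}(eqP py).
exact/level_vertex_subset/leq_pred.
Qed.

Lemma setT_unoccupied y C : y \notin C -> blocking y C <= 2^-1 -> setT \notin C.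
Proof.
move=> yC; apply: contraTN => TC; rewrite -ltNge; apply: (@lt_le_trans _ _ 1); first by lra.
have yT : y \proper setT by rewrite properT; apply: contraNneq yC => ->.
rewrite /blocking (bigD1 setT) ?TC //= cardsT card_ord binn invr1 lerDl.
by apply: sumr_ge0 => z _; rewrite invr_ge0.
Qed.

Lemma sum_sticks_le S C k s : (0 < k)%N -> S \subset level k -> spared S C ->
  (\sum_(y in S) sticks y C s <= ~~ [disjoint S & dla_step C s])%N.
Proof.
move=> k_gt0 /subsetP S_level /andP[disjSC /forallP unblocked].
have [|nostick] := boolP [exists y in S, sticks y C s]; last first.
  rewrite big1 // => y yS; apply/eqP; rewrite eqb0; apply: contra nostick => sticks_y.
  by apply/existsP; exists y; rewrite yS.
case/existsP=> y /andP[yS sticks_y]; have := S_level y yS; rewrite in_level => /eqP yk.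
rewrite (bigD1 y) //= big1 ?addn0.
  have yC : y \notin C by rewrite (disjointFr disjSC yS).
  have TC : setT \notin C by apply: setT_unoccupied yC _; apply: (implyP (unblocked y)).
  have ndisj : ~~ [disjoint S & dla_step C s].
    by apply/pred0Pn; exists y; rewrite /= yS sticks_dla_step // yk.
  by rewrite ndisj leq_b1.
move=> z /andP[zS]; have := S_level z zS; rewrite in_level => /eqP zk.
move: sticks_y => /and3P[py _ _]; rewrite (passesE s yk) in py.
apply: contraNeq; rewrite eqb0 negbK => /and3P[pz _ _].
by rewrite (passesE s zk) in pz; rewrite -(eqP py) eq_sym.
Qed.

Lemma prob_disjoint_dla_step_le S C k : (0 < k)%N -> S \subset level k ->
  (forall y, y \in S -> half_supported y C) -> spared S C ->
  avg (fun s => [disjoint S & dla_step C s]%:R) <= 1 - #|S|%:R / (4 * 'C(n, k))%:R :> R.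
Proof.
move=> k_gt0 S_level supported sparedSC.
rewrite lerBrDr; apply: le_trans (_ : avg (fun s => [disjoint S & dla_step C s]%:R) +
    avg (fun s => \sum_(y in S) (sticks y C s)%:R) <= _).
  rewrite lerD2l avg_sum mulr_natl -sumr_const; apply: ler_sum => y yS.
  have /eqP yk : #|y| == k by rewrite -in_level (subsetP S_level).
  rewrite -yk; apply: prob_sticks_ge; rewrite ?yk ?supported //.
  by move: sparedSC => /andP[_ /forallP/(_ y)/implyP]; apply.
rewrite -avgD -[X in _ <= X](avg_cst (card_perm_gt0 n)); apply: le_avg => s.
rewrite -natr_sum -natrD lern1.
apply: leq_trans (leq_add (leqnn _) (sum_sticks_le s k_gt0 S_level sparedSC)) _.
by case: [disjoint _ & _].
Qed.

Lemma sub_half_supported y C C' : C \subset C' -> half_supported y C -> half_supported y C'.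
Proof.
move=> CC' support; apply: leq_trans support _.
by rewrite leq_mul2l subset_leq_card ?setIS.
Qed.

Lemma sub_blocking y C C' : C \subset C' -> blocking y C <= blocking y C'.
Proof.
move=> CC'; rewrite /blocking !big_mkcondr /= [X in _ <= X](big_setID C) /= (setIidPr CC').
by rewrite lerDl; apply: sumr_ge0 => z _; case: ifP => // _; rewrite invr_ge0.
Qed.

Lemma sub_spared S C C' : C \subset C' -> spared S C' -> spared S C.
Proof.
move=> CC' /andP[disj /forallP unblocked]; rewrite /spared (disjointWr CC' disj) /=.
apply/forallP => y; apply/implyP => yS; apply: le_trans (sub_blocking y CC') _.
by move: (unblocked y) => /implyP; apply.
Qed.

Lemma prob_spared_le S C k d : (0 < k)%N -> S \subset level k ->
  (forall y, y \in S -> half_supported y C) ->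
  prob R d (fun l => spared S (foldl (@dla_step n) C l)) <=
  expR (- (#|S|%:R / (4 * 'C(n, k))%:R)) ^+ d.
Proof.
move=> k_gt0 S_level; set q := _ / _.
elim: d C => [|d IHd] C supported; first by rewrite expr0 lern1 leq_b1.
have q_ge0 : 0 <= expR (- q) ^+ d by rewrite exprn_ge0 ?expR_ge0.
have [sparedC|not_spared] := boolP (spared S C); last first.
  rewrite prob0 ?exprn_ge0 ?expR_ge0 // => l _; apply: contra not_spared.
  exact/sub_spared/sub_foldl_dla_step.
rewrite exprSr; apply: le_trans (_ :
    expR (- q) ^+ d * avg (fun s => [disjoint S & dla_step C s]%:R) <= _); last first.
  by rewrite ler_wpM2l // (le_trans _ (expR_ge1Dx _)) ?(prob_disjoint_dla_step_le k_gt0).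
rewrite -avgZ; apply: le_avg => s; have [disj|ndisj] := boolP [disjoint S & dla_step C s].
  rewrite mulr1; apply: IHd => y /supported; exact/sub_half_supported/sub_dla_step.
rewrite mulr0 [leLHS](_ : _ = 0) //; apply: prob0 => l _.
by apply: contra ndisj => /andP[+ _]; apply/disjointWr/sub_foldl_dla_step.
Qed.

End Sticking.

(** * Collisions and blocking *)

Section Exposure.
Local Open Scope ring_scope.
Variables (R : realType) (n : nat).
Implicit Types (s : 'S_n) (y : {set 'I_n}) (l : seq 'S_n).

(* Dominates what the walk s can add to the blocking of y by occupying a vertex
   at or below level a. *)
Definition exposure a y s : R :=
  \sum_(#|y|.+1 <= j < a.+1 | y \subset level_vertex s j) ('C(n - #|y|, j - #|y|)%:R)^-1.

Definition collides a l := ~~ uniq [seq level_vertex s a | s <- l].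

Definition overexposed a y l := 2^-1 < \sum_(s <- l) exposure a y s.

Lemma exposure_ge0 a y s : 0 <= exposure a y s.
Proof. by apply: sumr_ge0 => j _; rewrite invr_ge0. Qed.

Lemma exposure_le a y s : (3 * a <= n - #|y|)%N -> (#|y| < n)%N ->
  exposure a y s <= 2 / (n - #|y|)%:R.
Proof.
move=> an yn; have bin_first : 'C(n - #|y|, #|y|.+1 - #|y|) = (n - #|y|)%N.
  by rewrite subSnn bin1.
apply: le_trans (_ : \sum_(#|y|.+1 <= j < a.+1) ('C(n - #|y|, j - #|y|)%:R)^-1 <= _).
  rewrite /exposure big_mkcond; apply: ler_sum => j _; case: ifP => // _.
  by rewrite invr_ge0.
rewrite -[X in _ <= _ / X%:R]bin_first.
apply: (sum_inv_doubling_le R (c := fun j => 'C(n - #|y|, j - #|y|))) => [|j yj ja].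
  by rewrite bin_first subn_gt0.
by rewrite subSn; [apply: bin_double; lia | apply: ltnW].
Qed.

Lemma avg_exposure a y : (a <= n)%N ->
  avg (exposure a y) = \sum_(#|y|.+1 <= j < a.+1) ('C(n, j)%:R)^-1.
Proof.
move=> an; transitivity (avg (fun s => \sum_(#|y|.+1 <= j < a.+1)
    ('C(n - #|y|, j - #|y|)%:R)^-1 * (y \subset level_vertex s j)%:R) : R).
  apply: eq_avg => s; rewrite /exposure big_mkcond /=; apply: eq_bigr => j _.
  by case: (y \subset _); rewrite ?mulr1 ?mulr0.
rewrite avg_sum; apply: eq_big_nat => j /andP[yj ja].
have yjn : (#|y| <= j <= n)%N by lia.
rewrite avgZ prob_subset_level_vertex // mulKf // pnatr_eq0 -lt0n bin_gt0; lia.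
Qed.

Lemma avg_exposure_le a y : (3 * a < n)%N -> (#|y| < n)%N ->
  avg (exposure a y) <= 2 / 'C(n, #|y|.+1)%:R.
Proof.
move=> an yn; rewrite avg_exposure; last by lia.
apply: (sum_inv_doubling_le R (c := fun j => 'C(n, j))); first by rewrite bin_gt0.
by move=> j _ ja; apply: bin_double; lia.
Qed.

Lemma blocking_cluster_le a y l : (forall z, z \in cluster l -> #|z| <= a)%N ->
  blocking R y (cluster l) <= \sum_(s <- l) exposure a y s.
Proof.
elim/last_ind: l => [|l s IHl] cluster_le.
  rewrite big_nil /blocking big1 // => z /andP[]; rewrite inE => /eqP ->.
  by rewrite /proper sub0set andbF.
have {}IHl : blocking R y (cluster l) <= \sum_(r <- l) exposure a y r.
  apply: IHl => z zl; apply: cluster_le; rewrite /cluster foldl_rcons.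
  exact: (subsetP (sub_dla_step _ _)).
rewrite -[in leRHS]cats1 big_cat big_seq1 /=; move: cluster_le.
rewrite /cluster foldl_rcons -/(cluster l).
have [TC|TC] := boolP (setT \in cluster l).
  by rewrite /dla_step TC => _; rewrite (le_trans IHl) // lerDl exposure_ge0.
have s0C : level_vertex s 0 \in cluster l by rewrite level_vertex0 set0_cluster.
have [k [/andP[_ kn] _ -> avoided]] := dla_stepP (leq0n n) s0C TC => cluster_le.
rewrite /blocking big_mkcondr big_setU1 ?avoided ?ltnS ?leqnn //=.
rewrite -big_mkcondr -/(blocking R y (cluster l)) addrC; apply: lerD => //.
case: ifP => [y_proper|_]; last exact: exposure_ge0.
have k_le : (k.+1 <= a)%N by rewrite -(card_level_vertex s kn) cluster_le ?setU11.
have yk := proper_card y_proper; rewrite card_level_vertex // in yk *.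
rewrite /exposure big_mkcond (bigD1_seq k.+1) ?mem_index_iota ?iota_uniq ?yk //=.
rewrite (proper_sub y_proper) lerDl; apply: sumr_ge0 => j _.
by case: ifP => // _; rewrite invr_ge0.
Qed.

Lemma prob_overexposed_le a y t : (10 * a <= n)%N -> (#|y| < a)%N ->
  (16 * t <= 'C(n, #|y|.+1))%N ->
  prob R t (overexposed a y) <= expR (- ((n - #|y|)%:R / 16)).
Proof.
move=> an ya t_le; set m := (n - #|y|)%:R; set B : R := 'C(n, #|y|.+1)%:R.
have m_gt0 : 0 < m :> R by rewrite ltr0n subn_gt0; lia.
have B_gt0 : 0 < B by rewrite ltr0n bin_gt0; lia.
have lambda_ge0 : 0 <= m / 4 by rewrite divr_ge0 // ltW.
have scaled_bounds s : 0 <= m / 4 * exposure a y s <= 2^-1.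
  rewrite mulr_ge0 ?exposure_ge0 //= (_ : 2^-1 = m / 4 * (2 / m)).
    by apply: (ler_wpM2l lambda_ge0); apply: exposure_le; lia.
  by field; rewrite gt_eqF.
apply: le_trans (prob_sum_gt_le (card_perm_gt0 n) _ _ lambda_ge0 scaled_bounds) _.
rewrite ler_expR; have tB : t%:R / B <= 16^-1.
  by rewrite ler_pdivrMr // mulrC ler_pdivlMr // -natrM ler_nat mulnC.
have avg_le : avg (exposure a y) * t%:R <= 8^-1.
  apply: le_trans (_ : 2 / B * t%:R <= _); first by rewrite ler_wpM2r ?avg_exposure_le //; lia.
  by rewrite mulrAC -mulrA; lra.
have := ler_wpM2l lambda_ge0 avg_le; lra.
Qed.

Lemma prob_collides_le a t : (a <= n)%N -> prob R t (collides a) <= t%:R ^+ 2 / 'C(n, a)%:R.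
Proof.
move=> an; have bin_gt0R : (0 : R) < 'C(n, a)%:R by rewrite ltr0n bin_gt0.
elim: t => [|t IHt]; first by rewrite /prob /collides expr0n mul0r.
have collides_rcons l s : ((collides a (l ++ [:: s]))%:R : R) <=
    (collides a l)%:R + \sum_(r <- l) (passes s (level_vertex r a))%:R.
  rewrite /collides map_cat cats1 rcons_uniq negb_and negbK -natr_sum -natrD ler_nat.
  case: (boolP (uniq _)) => _ /=; last by rewrite orbT.
  rewrite orbF add0n; case: (boolP (_ \in _)) => // /mapP[r rl s_eq_r].
  by rewrite (big_rem r) //= (passesE s (card_level_vertex r an)) s_eq_r eqxx.
have prob_step l : size l = t ->
    avg (fun s => (collides a (l ++ [:: s]))%:R) <=
    (collides a l)%:R + t%:R / 'C(n, a)%:R :> R.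
  move=> sl; apply: le_trans (le_avg (collides_rcons l)) _.
  rewrite avgD avg_cst ?card_perm_gt0 // lerD2l avg_sum.
  rewrite (eq_bigr (fun=> ('C(n, a)%:R)^-1)) => [|r _]; last first.
    by rewrite prob_passes card_level_vertex.
  by rewrite big_const_seq count_predT iter_addr_0 sl mulr_natl.
rewrite -addn1 /prob expect_cat; apply: le_trans (le_expect prob_step) _.
rewrite expectD expect_cst ?card_perm_gt0 //.
apply: le_trans (lerD IHt (lexx _)) _; rewrite -mulrDl ler_wpM2r ?invr_ge0 //.
by have := ler0n R t; rewrite natrD; nra.
Qed.

End Exposure.

(** * Filling the levels one after another *)

Section Filling.
Local Open Scope ring_scope.
Variables (R : realType) (n : nat) (eps : R).
Hypotheses (eps_gt0 : 0 < eps) (eps_le : eps <= 100^-1).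
Implicit Types (x y : {set 'I_n}) (C S : {set {set 'I_n}}) (l : seq 'S_n).

Definition level_supported k C : Prop :=
  forall x, x \in level k.+1 -> #|shadow x :\: C|%:R <= 2 * eps * k.+1%:R.

Definition fill_time k := ('C(n, k.+1) %/ 16)%N.

Definition top_level := (n %/ 10)%N.

Definition persists t1 t2 S l :=
  [forall y in S, half_supported y (cluster (take t1 l))] && spared R S (cluster (take t2 l)).

Definition large_vacancy k S l :=
  (2 * eps * k.+2%:R < #|S|%:R) && persists (fill_time k) (fill_time k.+1) S l.

(* Concerns the passage from level k, at time t_k, to level k+1, at time t_(k+1). *)
Definition obstructed k l :=
  let l' := take (fill_time k.+1) l in
  [|| collides top_level l', [exists y in level k.+1, overexposed R top_level y l'] |
      [exists x in level k.+2, [exists S in powerset (shadow x), large_vacancy k S l]]].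

Lemma level_supported0 C : set0 \in C -> level_supported 0 C.
Proof.
move=> s0C x; rewrite in_level => /eqP card_x.
rewrite eq_card0 ?mulr_ge0 ?(ltW eps_gt0) // => y; rewrite in_setD inE card_x eqSS eq_sym.
by rewrite cards_eq0; apply/and3P => -[yC _ /eqP y0]; rewrite y0 s0C in yC.
Qed.

Lemma level_supported_count k C : (k < n)%N -> level_supported k C ->
  (1 - 2 * eps) * 'C(n, k)%:R <= (level_count C k)%:R.
Proof.
move=> kn supported; rewrite -[n in 'C(n, k)]card_ord.
have -> : level_count C k = #|level k :&: C|.
  by apply: eq_card => x; rewrite !inE andbC.
have vacant_le : #|level k :\: C|%:R <= 2 * eps * 'C(#|'I_n|, k)%:R :> R.
  rewrite setDE; apply: card_level_setI_le => [|x /supported]; by rewrite ?card_ord ?setDE.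
have : #|level k :&: C|%:R + #|level k :\: C|%:R = 'C(#|'I_n|, k)%:R :> R.
  by rewrite -natrD cardsID card_level.
lra.
Qed.

Lemma level_supported_half k C y : level_supported k C -> y \in level k.+1 ->
  half_supported y C.
Proof.
move=> supported yk; have := supported y yk; move: yk; rewrite in_level => /eqP yk.
have := cardsID C (shadow y); rewrite card_shadow /half_supported yk => count vacant_le.
suff : (2 * #|shadow y :\: C| <= k.+1)%N by lia.
rewrite -(ler_nat R) natrM; have k_ge0 := ler0n R k.+1.
have := ler_wpM2r k_ge0 eps_le; lra.
Qed.

Lemma level_supported_step k l : (0 < top_level)%N ->
  level_supported k (cluster (take (fill_time k) l)) -> ~~ obstructed k l ->
  level_supported k.+1 (cluster (take (fill_time k.+1) l)).
Proof.
rewrite /obstructed; set l' := take (fill_time k.+1) l; set C := cluster l'.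
move=> top_level_gt0 supported; rewrite !negb_or => /and3P[/negPn no_collision].
move=> /exists_inPn not_exposed /exists_inPn no_vacancy x xk.
rewrite leNgt; apply/negP => many_vacant.
have vacant_level : shadow x :\: C \subset level k.+1.
  by apply/subsetP => y; rewrite in_setD => /andP[_ /(shadow_level xk)].
have /exists_inPn/(_ (shadow x :\: C)) := no_vacancy x xk.
rewrite powersetE subsetDl /large_vacancy many_vacant /persists /spared -/C /=.
move=> /(_ isT)/negP; apply; apply/and3P; split.
- apply/forallP => y; apply/implyP => /(subsetP vacant_level); exact: level_supported_half.
- by rewrite disjoint_sym disjoints_subset setDE setCI setCK subsetUr.
apply/forallP => y; apply/implyP => /(subsetP vacant_level) yk.
have := not_exposed y yk; rewrite /overexposed -leNgt; apply: le_trans.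
apply: blocking_cluster_le => z; apply: card_cluster_le => //.
by rewrite top_level_gt0 leq_div.
Qed.

Lemma fill_time_le k : (fill_time k <= 2 ^ n)%N.
Proof. exact: leq_trans (leq_div _ _) (bin_le_exp2 _ _). Qed.

Lemma fill_time_mono k : (3 * k.+1 + 2 <= n)%N -> (fill_time k <= fill_time k.+1)%N.
Proof.
by move=> kn; apply: leq_div2r; apply: leq_trans (bin_double kn); apply: leq_pmull.
Qed.

Lemma fill_time_growth k : (1000 * k.+2 <= n)%N ->
  (n * 'C(n, k.+1) <= 32 * k.+2 * (fill_time k.+1 - fill_time k))%N.
Proof.
move=> kn; have t_le : (fill_time k <= fill_time k.+1)%N by apply: fill_time_mono; lia.
have bin_ge1 : (0 < 'C(n, k.+1))%N by rewrite bin_gt0; lia.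
have next_le : ('C(n, k.+2) <= 16 * (fill_time k.+1 - fill_time k) + 15 + 'C(n, k.+1))%N.
  move: t_le; rewrite /fill_time {2}(divn_eq 'C(n, k.+1) 16) {1}(divn_eq 'C(n, k.+2) 16).
  by have := ltn_pmod 'C(n, k.+2) (ltn0Sn 15); lia.
have pascal_le : ((n - k.+1) * 'C(n, k.+1) <=
    k.+2 * (16 * (fill_time k.+1 - fill_time k)) + 16 * k.+2 * 'C(n, k.+1))%N.
  by rewrite -mul_bin_left; apply: leq_trans (leq_mul (leqnn k.+2) next_le) _; nia.
have codim_large :
    (n * 'C(n, k.+1) + 32 * k.+2 * 'C(n, k.+1) <= 2 * ((n - k.+1) * 'C(n, k.+1)))%N.
  by rewrite mulnA -mulnDl; apply: leq_mul => //; lia.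
nia.
Qed.

Lemma prob_persists_le k t1 t2 T S : (0 < k)%N -> (t1 <= t2 <= T)%N -> S \subset level k ->
  prob R T (persists t1 t2 S) <=
  expR (- (#|S|%:R / (4 * 'C(n, k))%:R * (t2 - t1)%:R)).
Proof.
move=> k_gt0 /andP[t12 t2T] S_level.
rewrite (eq_prob R (Q := fun l => persists t1 t2 S (take t2 l))) => [|l _]; last first.
  by rewrite /persists !take_takel.
rewrite (prob_take R (card_perm_gt0 n) _ t2T) -[X in prob _ X](subnKC t12).
rewrite /prob expect_cat -[leRHS](expect_cst (card_perm_gt0 n) t1).
apply: le_expect => l size_l; rewrite -mulNr expRM_natr.
have [supported|unsupported] :=
  boolP [forall y in S, half_supported y (cluster l)]; last first.
  rewrite [leLHS](_ : _ = 0) ?exprn_ge0 ?expR_ge0 //; apply: prob0 => l' _.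
  by rewrite /persists take_size_cat // (negbTE unsupported).
apply: le_trans (prob_spared_le R (t2 - t1) k_gt0 S_level (C := cluster l) _) => [|y yS].
  apply: le_prob => l' size_l'; rewrite /persists take_size_cat // supported take_oversize.
    by rewrite /cluster foldl_cat.
  by rewrite size_cat size_l size_l' subnKC.
by move/forallP: supported => /(_ y)/implyP; apply.
Qed.

Lemma prob_persists_large_le k T S : (1000 * k.+2 <= n)%N -> (fill_time k.+1 <= T)%N ->
  S \subset level k.+1 -> 2 * eps * k.+2%:R < #|S|%:R ->
  prob R T (persists (fill_time k) (fill_time k.+1) S) <= expR (- (eps * n%:R / 64)).
Proof.
move=> kn tT S_level S_large.
have t_le : (fill_time k <= fill_time k.+1 <= T)%N by rewrite fill_time_mono //; lia.
apply: le_trans (prob_persists_le (ltn0Sn k) t_le S_level) _; rewrite ler_expR lerN2 natrM.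
have := fill_time_growth kn; set d := (_ - _)%N; rewrite -(ler_nat R) !natrM.
have bin_gt0R : (0 : R) < 'C(n, k.+1)%:R by rewrite ltr0n bin_gt0; lia.
rewrite -ler_pdivlMr // -mulrA => growth.
have -> : #|S|%:R / (4 * 'C(n, k.+1)%:R) * d%:R = #|S|%:R * (d%:R / 'C(n, k.+1)%:R) / 4 :> R.
  by field; rewrite gt_eqF.
have rate_ge0 : 0 <= d%:R / 'C(n, k.+1)%:R :> R by rewrite divr_ge0.
have := ler_wpM2r rate_ge0 (ltW S_large); have := ler_wpM2l (ltW eps_gt0) growth; lra.
Qed.

End Filling.

(** * Union bound *)

Lemma bin_exp_le_expR (R : realType) n j (u : R) :
  (0 <= u -> 'C(n, j)%:R * u ^+ j <= expR (u * n%:R))%R.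
Proof.
move=> u_ge0; apply: (@le_trans _ _ ((1 + u) ^+ n)%R); last first.
  by rewrite expRM_natr lerXn2r ?nnegrE ?expR_ge0 ?expR_ge1Dx // addr_ge0.
have [jn|nj] := leqP j n; last by rewrite bin_small // mul0r exprn_ge0 // addr_ge0.
rewrite exprDn (bigD1 (Ordinal (n := n.+1) (m := j) jn)) //= expr1n mul1r mulr_natl lerDl.
by apply: sumr_ge0 => i _; rewrite expr1n mul1r mulrn_wge0 // exprn_ge0.
Qed.

Lemma expR_half_le_exp2 (R : realType) m : (expR (m%:R / 2) <= 2 ^+ m :> R)%R.
Proof.
rewrite mulrC expRM_natr lerXn2r ?nnegrE ?expR_ge0 //.
by have := @expR_le1D2x R 2^-1; lra.
Qed.

Lemma linear_le_expR_sqr (R : realType) (v : R) :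
  (100 <= v -> 400 * v <= expR (v ^+ 2 / 400))%R.
Proof.
move=> v_ge; set x := (v ^+ 2 / 400)%R.
have x_ge : (25 <= x)%R by rewrite /x; nra.
have v_le : (v <= 4 * x)%R by rewrite /x; nra.
apply: le_trans (expR_ge1Dxn 4 (le_trans (ler0n _ 25) x_ge)).
have : (25 ^+ 4 * x <= x ^+ 5)%R.
  by rewrite [leRHS]exprSr ler_wpM2r ?lerXn2r ?nnegrE //; lra.
have -> : (5`!%:R = 120 :> R)%R by [].
lra.
Qed.

Section UnionBound.
Local Open Scope ring_scope.
Variables (R : realType) (n : nat) (eps : R).
Hypotheses (eps_gt0 : 0 < eps) (eps_le : eps <= 100^-1).
Hypothesis n_large : 1 <= eps ^+ 3 * n%:R.
Implicit Types (x y : {set 'I_n}) (S : {set {set 'I_n}}) (l : seq 'S_n).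

Definition low_level k := k%:R < eps ^+ 3 * n%:R.

Definition levels_filled l :=
  [forall k : 'I_n.+1, low_level k ==>
     ((1 - 2 * eps) * 'C(n, k)%:R <= (level_count (cluster l) k)%:R)].

Lemma low_level_bound k : low_level k -> (1000 * k.+1 <= n)%N.
Proof.
rewrite /low_level => low; rewrite -(ler_nat R) natrM -[k.+1%:R]natr1.
have eps3_le : eps ^+ 3 <= 10000^-1.
  apply: le_trans (_ : 100^-1 ^+ 3 <= _); last by lra.
  by rewrite lerXn2r ?nnegrE ?invr_ge0 ?(ltW eps_gt0).
move: n_large low (ler_wpM2r (ler0n R n) eps3_le).
set w := eps ^+ 3 * n%:R; lra.
Qed.

Lemma low_level_pred k : low_level k.+1 -> low_level k.
Proof. by apply: le_lt_trans; rewrite ler_nat. Qed.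

Lemma n_ge1000 : (1000 <= n)%N.
Proof.
have low0 : low_level 0 by apply: lt_le_trans n_large; rewrite ltr01.
by have := low_level_bound low0; rewrite muln1.
Qed.

Lemma top_level_bounds : (10 * top_level n <= n < 10 * top_level n + 10)%N.
Proof. by rewrite /top_level mulnC leq_divM /= {1}(divn_eq n 10) ltn_add2l ltn_pmod. Qed.

Lemma bin_exp2_le_expR k : low_level k ->
  'C(n, k.+1)%:R * 2 ^+ k.+1 <= expR (eps * n%:R / 100) :> R.
Proof.
rewrite /low_level => low; pose u := eps / 200; pose v := eps^-1.
have u_ge0 : 0 <= u by rewrite divr_ge0 // ltW.
have two_div_u : 2 / u = 400 * v by rewrite /u /v; field; rewrite gt_eqF.
have v_ge : 100 <= v by rewrite -[100]invrK /v lef_pV2 ?posrE ?invr_gt0.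
have -> : 'C(n, k.+1)%:R * 2 ^+ k.+1 = 'C(n, k.+1)%:R * u ^+ k.+1 * (400 * v) ^+ k.+1.
  by rewrite -two_div_u -mulrA -exprMn mulrCA divff ?mulr1 // gt_eqF ?divr_gt0.
apply: le_trans (_ : expR (u * n%:R) * expR (v ^+ 2 / 400) ^+ k.+1 <= _).
  have base_ge0 : 0 <= 400 * v by lra.
  apply: ler_pM; rewrite ?mulr_ge0 ?exprn_ge0 ?bin_exp_le_expR //.
  by rewrite lerXn2r ?nnegrE ?expR_ge0 ?linear_le_expR_sqr.
rewrite -expRM_natr -expRD ler_expR.
have k_le : k.+1%:R <= 2 * (eps ^+ 3 * n%:R) by rewrite mulr_natl mulr2n -natr1 lerD // ltW.
have rate_ge0 : 0 <= v ^+ 2 / 400 by rewrite divr_ge0 // exprn_ge0; lra.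
apply: le_trans (lerD (lexx _) (ler_wpM2l rate_ge0 k_le)) _.
by rewrite /u /v le_eqVlt; apply/orP; left; apply/eqP; field; rewrite gt_eqF.
Qed.

Lemma bin_le_expR k : low_level k -> 'C(n, k.+1)%:R <= expR (eps * n%:R / 100) :> R.
Proof.
move=> /bin_exp2_le_expR; apply: le_trans.
by rewrite ler_peMr ?ler0n // exprn_ege1 ?ler1n.
Qed.

Lemma prob_filling_collides_le k : low_level k.+1 ->
  prob R (2 ^ n) (fun l => collides (top_level n) (take (fill_time n k.+1) l)) <=
  expR (- (eps * n%:R / 200)).
Proof.
move=> low; have /andP[top_le top_gt] := top_level_bounds.
rewrite (prob_take R (card_perm_gt0 n) _ (fill_time_le _ _)).
apply: le_trans (prob_collides_le R _ (leq_div _ _)) _; rewrite ler_pdivrMr; last first.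
  by rewrite ltr0n bin_gt0 leq_div.
have time_le : (fill_time n k.+1)%:R <= expR (eps * n%:R / 100) :> R.
  by apply: le_trans (bin_le_expR low); rewrite ler_nat leq_div.
have bin_ge : expR ((top_level n)%:R / 2) <= 'C(n, top_level n)%:R :> R.
  apply: le_trans (expR_half_le_exp2 _ _) _; rewrite -natrX ler_nat; apply: exp2_le_bin; lia.
apply: le_trans (_ : expR (eps * n%:R / 100) ^+ 2 <= _).
  by rewrite lerXn2r ?nnegrE ?expR_ge0.
apply: le_trans (ler_wpM2l (expR_ge0 _) bin_ge); rewrite -expRM_natl -expRD ler_expR.
have n_ge : 1000 <= n%:R :> R by rewrite ler_nat n_ge1000.
have n_lt : n%:R < 10 * (top_level n)%:R + 10 :> R by rewrite -natrM -natrD ltr_nat.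
have := ler_wpM2r (ler0n R n) eps_le; lra.
Qed.

Lemma prob_filling_overexposed_le k : low_level k.+1 ->
  prob R (2 ^ n) (fun l => [exists y in level k.+1,
    overexposed R (top_level n) y (take (fill_time n k.+1) l)]) <=
  expR (- (eps * n%:R / 200)).
Proof.
move=> low; have /andP[top_le top_gt] := top_level_bounds; have kn := low_level_bound low.
have tail_le y : y \in level k.+1 -> prob R (2 ^ n) (fun l =>
    overexposed R (top_level n) y (take (fill_time n k.+1) l)) <= expR (- (n%:R / 32)).
  rewrite in_level => /eqP yk; rewrite (prob_take R (card_perm_gt0 n) _ (fill_time_le _ _)).
  apply: le_trans (prob_overexposed_le R top_le _ _) _; rewrite yk; first by lia.
    by rewrite mulnC leq_divM.
  have codim_ge : n%:R <= 2 * (n - k.+1)%:R :> R by rewrite -natrM ler_nat; lia.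
  by rewrite ler_expR; lra.
apply: le_trans (prob_exists tail_le) _; rewrite card_level card_ord.
apply: le_trans (_ : expR (eps * n%:R / 100) * expR (- (n%:R / 32)) <= _).
  by rewrite ler_wpM2r ?expR_ge0 ?(bin_le_expR (low_level_pred low)).
have n_ge0 := ler0n R n; rewrite -expRD ler_expR.
by have := ler_wpM2r n_ge0 eps_le; lra.
Qed.

Lemma prob_filling_large_vacancy_le k : low_level k.+1 ->
  prob R (2 ^ n) (fun l => [exists x in level k.+2,
    [exists S in powerset (shadow x), large_vacancy eps k S l]]) <=
  expR (- (eps * n%:R / 200)).
Proof.
move=> low; have kn := low_level_bound low; set q := expR (- (eps * n%:R / 64)).
have tail_le x S : x \in level k.+2 -> S \in powerset (shadow x) ->
    prob R (2 ^ n) (large_vacancy eps k S) <= q.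
  rewrite /large_vacancy powersetE => xk /subsetP S_shadow.
  case: (boolP (2 * eps * _ < _)) => [S_large|_]; last by rewrite prob0 ?expR_ge0.
  apply: prob_persists_large_le S_large => //; first exact: fill_time_le.
  by apply/subsetP => y /S_shadow; apply: shadow_level.
have shadow_tail_le x : x \in level k.+2 ->
    prob R (2 ^ n) (fun l => [exists S in powerset (shadow x), large_vacancy eps k S l]) <=
    2 ^+ k.+2 * q.
  move=> xk; apply: le_trans (prob_exists (fun S => tail_le x S xk)) _.
  by rewrite card_powerset card_shadow natrX; move: xk; rewrite in_level => /eqP ->.
apply: le_trans (prob_exists shadow_tail_le) _; rewrite card_level card_ord mulrA.
apply: le_trans (ler_wpM2r (expR_ge0 _) (bin_exp2_le_expR low)) _.
have eps_n_ge0 : 0 <= eps * n%:R by rewrite mulr_ge0 // ltW.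
by rewrite -expRD ler_expR; lra.
Qed.

Lemma prob_obstructed_le k : low_level k.+1 ->
  prob R (2 ^ n) (fun l : seq 'S_n => obstructed eps k l) <= 3 * expR (- (eps * n%:R / 200)).
Proof.
move=> low; apply: le_trans (prob_or _ _ _ _) _.
apply: le_trans (lerD (prob_filling_collides_le low) (prob_or _ _ _ _)) _.
have := lerD (prob_filling_overexposed_le low) (prob_filling_large_vacancy_le low); lra.
Qed.

Lemma levels_filled_unobstructed l :
  (forall k, low_level k.+1 -> ~~ obstructed eps k l) -> levels_filled l.
Proof.
move=> unobst; have top_level_gt0 : (0 < top_level n)%N.
  by rewrite divn_gt0 //; have := n_ge1000; lia.
have supported k : low_level k -> level_supported eps k (cluster (take (fill_time n k) l)).
  elim: k => [|k IHk] low; first exact/level_supported0/set0_cluster.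
  by apply: level_supported_step => //; [exact/IHk/low_level_pred | exact: unobst].
apply/forallP => k; apply/implyP => low.
have kn : (k < n)%N by have := low_level_bound low; lia.
apply: le_trans (level_supported_count kn (supported k low)) _; rewrite ler_nat.
apply: subset_leq_card; apply/subsetP => y; rewrite !inE => /andP[yC ->].
by rewrite andbT (subsetP (sub_cluster_take _ _) y yC).
Qed.

Lemma prob_levels_filled_ge :
  1 - n%:R * (3 * expR (- (eps * n%:R / 200))) <= prob R (2 ^ n) levels_filled.
Proof.
pose low_levels := [set k : 'I_n | low_level k.+1]; set q := 3 * _.
have obstructed_le : prob R (2 ^ n) (fun l => [exists k in low_levels, obstructed eps k l]) <=
    n%:R * q.
  apply: le_trans (prob_exists (q := q) _) _ => [k|].
    by rewrite inE; apply: prob_obstructed_le.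
  rewrite ler_wpM2r ?mulr_ge0 ?expR_ge0 // ler_nat -[n in (_ <= n)%N]card_ord; exact: max_card.
apply: le_trans (lerB (lexx 1) obstructed_le) _; rewrite -probC; last exact: card_perm_gt0.
apply: le_prob => l _ /exists_inPn unobst; apply: levels_filled_unobstructed => k low.
have kn : (k < n)%N by have := low_level_bound low; lia.
by apply: (unobst (Ordinal kn)); rewrite inE.
Qed.

End UnionBound.

(** * The limit of the probability *)

Section Limit.
Local Open Scope ring_scope.

Lemma natr_mul_expRN_small (R : realType) (c delta : R) : 0 < c -> 0 < delta ->
  exists N : nat, forall n, (N <= n)%N -> n%:R * expR (- (c * n%:R)) <= delta.
Proof.
move=> c_gt0 delta_gt0; have rate_gt0 : 0 < c ^+ 2 * delta by rewrite mulr_gt0 ?exprn_gt0.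
exists (Num.trunc (2 / (c ^+ 2 * delta))).+1 => n.
rewrite truncn_lt_nat ?divr_ge0 ?(ltW rate_gt0) // ltr_pdivrMr // => /ltW n_large.
rewrite expRN ler_pdivrMr ?expR_gt0 //.
have cn_ge0 : 0 <= c * n%:R by rewrite mulr_ge0 // ltW.
have quadratic_le : (c * n%:R) ^+ 2 / 2 <= expR (c * n%:R).
  by apply: le_trans (expR_ge1Dxn 1 cn_ge0); rewrite lerDr.
apply: le_trans (ler_wpM2l (ltW delta_gt0) quadratic_le).
have -> : delta * ((c * n%:R) ^+ 2 / 2) = n%:R * (n%:R * (c ^+ 2 * delta) / 2) by field.
by rewrite ler_peMr // ler_pdivlMr // mul1r.
Qed.

Lemma RlebE (a b : Rdefinitions.R) : Defs.Rleb a b = (a <= b).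
Proof.
by rewrite /Defs.Rleb; case: Rle_dec => ab; apply/esym; [apply/RleP | apply/negP => /RleP].
Qed.

Lemma RltbE (a b : Rdefinitions.R) : Defs.Rltb a b = (a < b).
Proof.
by rewrite /Defs.Rltb; case: Rlt_dec => ab; apply/esym; [apply/RltP | apply/negP => /RltP].
Qed.

Lemma good_probE n (eps : Rdefinitions.R) :
  good_prob n eps = prob _ (2 ^ n) (fun l : seq 'S_n => levels_filled eps l).
Proof.
rewrite prob_ffun /good_prob RdivE !INRE; congr (_%:R / _); apply: eq_card => w; rewrite !inE.
apply: eq_forallb => k; rewrite RltbE RlebE /low_level.
by rewrite !(RmultE, RminusE, INRE, RpowE).
Qed.

End Limit.

Theorem theorem3 (eps : R) :
  Rlt 0 eps -> Rle eps (Rdiv 1 100) ->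
  forall delta : R, Rlt 0 delta ->
  exists N : nat, forall n : nat, N <= n ->
    Rle (Rminus 1 delta) (good_prob n eps).
Proof.
move=> /RltP eps_gt0 /RleP; rewrite RdivE R1E IZRposE INRE div1r => eps_le.
move=> delta /RltP delta_gt0.
have rate_gt0 : (0 < eps / 200)%R by rewrite divr_gt0.
have [N N_small] := natr_mul_expRN_small rate_gt0 (divr_gt0 delta_gt0 (ltr0n _ 3)).
have eps3_gt0 : (0 < eps ^+ 3)%R by rewrite exprn_gt0.
exists (maxn N (Num.trunc (eps ^+ 3)^-1)%R.+1) => n; rewrite geq_max => /andP[Nn].
rewrite truncn_lt_nat ?invr_ge0 ?(ltW eps3_gt0) // -div1r ltr_pdivrMr // mulrC => /ltW n_large.
apply/RleP; rewrite good_probE RminusE.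
apply: le_trans (prob_levels_filled_ge eps_gt0 eps_le n_large); rewrite lerD2l lerN2.
have := N_small n Nn; rewrite [(eps / 200 * _)%R]mulrAC ler_pdivlMr //.
by rewrite [in X in _ -> X]mulrCA mulrC.
Qed.
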